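(* Let $V$ be a non-negative random variable with distribution function $F_V\in\mathcal{S}$ (the subexponential class), and let $Y\sim\mathrm{PH}(\boldsymbol{\pi},\boldsymbol{T})$ be phase-type distributed and independent of $V$. Let $a:(0,\infty)\to(0,\infty)$ be a function such that: \begin{enumerate} \item $a(x)\uparrow\infty$ as $x\to\infty$; \item $x/a(x)\uparrow\infty$ as $x\to\infty$; \item $\sqrt{x}/a(x)\to 0$ as $x\to\infty$; \item $\lim_{x\to\infty}\overline{F}_V(x-a(x))/\overline{F}_V(x)=1$. \end{enumerate} Then $X=VY$ has subexponential tail behavior, i.e. the distribution function of $VY$ belongs to $\mathcal{S}$.
   Context: For a distribution function $F$, $\overline{F}=1-F$. A distribution function $F$ on $[0,\infty)$ is subexponential, $F\in\mathcal{S}$, if $\lim_{x\to\infty}\overline{F^{*2}}(x)/\overline{F}(x)=2$, where $F^{*2}=F*F$ is the two-fold convolution (in particular $\overline{F}(x)>0$ for all $x$). The notation $g(x)\uparrow\infty$ means that $g$ increases to infinity. $Y\sim\mathrm{PH}(\boldsymbol{\pi},\boldsymbol{T})$ means that $Y$ is the time until absorption of a time-homogeneous Markov jump process on $\{1,\dots,p,p+1\}$ with states $1,\dots,p$ transient and $p+1$ absorbing, with initial distribution $\boldsymbol{\pi}=(\pi_1,\dots,\pi_p)$ on the transient states (no mass at $p+1$) and $p\times p$ sub-intensity matrix $\boldsymbol{T}$; then $\mathbb{P}(Y>y)=\boldsymbol{\pi}e^{\boldsymbol{T}y}\boldsymbol{e}$ for $y>0$, with $\boldsymbol{e}$ the column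 vector of ones. *)

(* Defs.v *)
From HB Require Import structures.
From mathcomp Require Import all_boot all_order all_algebra.
From mathcomp Require Import all_classical all_reals all_analysis.

Set Implicit Arguments.
Unset Strict Implicit.
Unset Printing Implicit Defensive.

Import Order.TTheory GRing.Theory Num.Theory.
Import numFieldNormedType.Exports.

Local Open Scope classical_set_scope.
Local Open Scope ring_scope.

Definition tail (R : realType) (mu : set R -> \bar R) (x : R) : R :=
  fine (mu `]x, +oo[%classic).

Definition convolution (R : realType) (mu nu : probability R R) :
  set R -> \bar R :=
  pushforward (mu \x nu)%E (fun z : R * R => z.1 + z.2).

(* The class S, as a predicate on the law [mu] whose distribution function is
   F.  Positivity of the tail is required explicitly because division by zero
   is total in MathComp. *)
Definition subexponential (R : realType) (mu : probability R R) : Prop :=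
  [/\ mu `]-oo, 0[%classic = 0%E,
      forall x : R, 0 < tail mu x
    & tail (convolution mu mu) x / tail mu x @[x --> +oo] --> (2 : R)].

Definition independent_RV (d : measure_display) (Omega : measurableType d)
    (R : realType) (P : probability Omega R) (X Y : {RV P >-> R}) : Prop :=
  forall A B : set R, measurable A -> measurable B ->
    P (X @^-1` A `&` Y @^-1` B) = (P (X @^-1` A) * P (Y @^-1` B))%E.

(* Entrywise sum of the exponential series, which always converges. *)
Definition mxexp (R : realType) (n : nat) (A : 'M[R]_n) : 'M[R]_n :=
  \matrix_(i, j) limn (series (fun k => (A ^+ k) i j / k`!%:R)).

(* [J] is a time-homogeneous Markov jump process in time [0, +oo[ with initial
   distribution [mu] and intensity matrix [Q], i.e. with transition matrices
   [mxexp (h *: Q)].  The Markov property is written without conditional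
   probabilities so that conditioning on null events does not arise.
   The last two fields say that every path is right-continuous and piecewise
   constant, with finitely many jumps in bounded intervals. *)
Record markov_jump_process (R : realType) (d : measure_display)
    (Omega : measurableType d) (P : probability Omega R) (n : nat)
    (mu : 'rV[R]_n) (Q : 'M[R]_n) (J : R -> Omega -> 'I_n) : Prop := {
  mjp_measurable : forall (t : R) (i : 'I_n), 0 <= t ->
    measurable [set w | J t w = i];
  mjp_initial : forall i : 'I_n, P [set w | J 0 w = i] = (mu ord0 i)%:E;
  mjp_markov : forall (m : nat) (t : nat -> R) (x : nat -> 'I_n) (h : R)
      (j : 'I_n),
    0 <= t 0%N -> nondecreasing_seq t -> 0 <= h ->
    let past := [set w | forall k, (k <= m)%N -> J (t k) w = x k] in
    P (past `&` [set w | J (t m + h) w = j]) =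
      (P past * (mxexp (h *: Q) (x m) j)%:E)%E;
  mjp_right : forall (w : Omega) (t : R), 0 <= t ->
    exists2 e : R, 0 < e & forall s : R, t <= s < t + e -> J s w = J t w;
  mjp_left : forall (w : Omega) (t : R), 0 < t ->
    exists2 e : R, 0 < e &
      exists i : 'I_n, forall s : R, 0 <= s -> t - e < s < t -> J s w = i
}.

(* The chain with intensity matrix [Q] started at [i] almost surely does not
   visit [i] at arbitrarily large times.  The law of the chain is determined by
   [Q] and [i], so the choice of the process realizing it is immaterial. *)
Definition transient_state (R : realType) (n : nat) (Q : 'M[R]_n) (i : 'I_n) :
  Prop :=
  exists (d : measure_display) (Omega : measurableType d)
    (P : probability Omega R) (J : R -> Omega -> 'I_n),
    markov_jump_process P (delta_mx ord0 i) Q J /\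
    P.-negligible [set w | forall t : R, exists2 s : R,
                             0 <= s /\ t <= s & J s w = i].

Definition sub_intensity (R : realType) (p : nat) (T : 'M[R]_p) : Prop :=
  (forall i j : 'I_p, i != j -> 0 <= T i j) /\
  (forall i : 'I_p, \sum_j T i j <= 0).

(* States 1, ..., p are the [lshift 1 i]; state p+1 is [absorbing p]. *)
Definition absorbing (p : nat) : 'I_(p + 1) := rshift p ord0.

Definition absorbing_intensity (R : realType) (p : nat) (T : 'M[R]_p) :
  'M[R]_(p + 1) :=
  block_mx T (- (T *m const_mx 1)) 0 0.

(* Equal to +oo when the process is never absorbed. *)
Definition absorption_time (R : realType) (p : nat) (Omega : Type)
    (J : R -> Omega -> 'I_(p + 1)) (w : Omega) : \bar R :=
  ereal_inf [set t%:E | t in [set t : R | 0 <= t /\ J t w = absorbing p]].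

(* Y ~ PH(pi, T): [Y] has the law of the absorption time.  The process may live
   on a probability space other than that of [Y]. *)
Definition phase_type (R : realType) (d : measure_display)
    (Omega : measurableType d) (P : probability Omega R) (p : nat)
    (pi : 'rV[R]_p) (T : 'M[R]_p) (Y : {RV P >-> R}) : Prop :=
  [/\ (forall i, 0 <= pi ord0 i) /\ \sum_i pi ord0 i = 1,
      sub_intensity T,
      forall i : 'I_p, transient_state (absorbing_intensity T) (lshift 1 i)
    & exists (d' : measure_display) (Omega' : measurableType d')
        (P' : probability Omega' R) (J : R -> Omega' -> 'I_(p + 1)),
        markov_jump_process P' (row_mx pi 0) (absorbing_intensity T) J /\
        forall y : R,
          cdf Y y = P' [set w | (absorption_time J w <= y%:E)%E]].

(* Main.v *)
Require Import Defs.
From HB Require Import structures.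
From mathcomp Require Import all_boot all_order all_algebra.
From mathcomp Require Import all_classical all_reals all_analysis.
From mathcomp Require Import measurable_realfun ring lra.

Set Implicit Arguments.
Unset Strict Implicit.
Unset Printing Implicit Defensive.

Import Order.TTheory GRing.Theory Num.Theory.
Import numFieldNormedType.Exports.

Local Open Scope classical_set_scope.
Local Open Scope ring_scope.

(* The core is the argument of Cline and Samorodnitsky: if F is subexponential,
   a(x) and x/a(x) increase to infinity, F(x - a(x))/F(x) -> 1 for the tails,
   and P(Y > a(x)) = o(P(VY > x)), then VY is subexponential.  Conditionally on
   Y1 = y1 and Y2 = y2 with c <= y1, y2 <= a(x), the event V1 y1 + V2 y2 > x
   forces, with m = max(y1, y2), either Vi yi > x - K m for some i, where the
   shift is negligible because K m / yi is at most a multiple of a(x/yi), or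
   V1, V2 > K and V1 + V2 > x/m, which subexponentiality of F makes negligible.
   Values Yi < c are replaced by c, at the price of a factor
   1 + P(Y <= c)/P(Y > c).

   For phase-type Y the tail lies between two exponentials, whereas V has at
   least an exponential tail by the insensitivity condition; hence
   P(VY > x) >= P(V > sqrt x) P(Y > sqrt x) >= C exp(-l sqrt x), which dominates
   P(Y > a(x)) <= C' exp(-b a(x)) since sqrt x = o(a(x)).  The exponential decay
   of P(Y > y) follows from transience by a pigeonhole argument: if the chain is
   alive at times 0, N, ..., pN, it visits one of the p transient states at two
   of these times. *)

(** * Probabilities as real numbers *)

Section ProbabilityValues.
Context (d : measure_display) (S : measurableType d) (R : realType).
Implicit Types (P : probability S R) (A B : set S).

Definition pr P A : R := fine (P A).

Lemma prK P A : measurable A -> P A = (pr P A)%:E.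
Proof. by move=> mA; rewrite /pr fineK// fin_num_measure. Qed.

Lemma pr_ge0 P A : 0 <= pr P A.
Proof. by rewrite /pr fine_ge0. Qed.

Lemma pr_le1 P A : measurable A -> pr P A <= 1.
Proof. by move=> mA; rewrite -lee_fin -prK// probability_le1. Qed.

Lemma prT P : pr P setT = 1.
Proof. by rewrite /pr probability_setT. Qed.

Lemma pr0 P : pr P set0 = 0.
Proof. by rewrite /pr measure0. Qed.

Lemma pr_le P A B : measurable A -> measurable B -> A `<=` B ->
  pr P A <= pr P B.
Proof. by move=> mA mB AB; rewrite -lee_fin -!prK// le_measure ?inE. Qed.

Lemma prU_le P A B : measurable A -> measurable B ->
  pr P (A `|` B) <= pr P A + pr P B.
Proof.
move=> mA mB; rewrite -lee_fin EFinD -!prK//; last exact: measurableU.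
exact: measureU2.
Qed.

Lemma prU P A B : measurable A -> measurable B -> A `&` B = set0 ->
  pr P (A `|` B) = pr P A + pr P B.
Proof.
move=> mA mB AB; apply: EFin_inj; rewrite EFinD -!prK//; last exact: measurableU.
exact: measureU.
Qed.

Lemma prC P A : measurable A -> pr P (~` A) = 1 - pr P A.
Proof.
move=> mA; apply: EFin_inj.
by rewrite EFinB -!prK ?probability_setC//; exact: measurableC.
Qed.

Lemma measurable_set_lt (f g : S -> R) : measurable_fun setT f ->
  measurable_fun setT g -> measurable [set z | f z < g z].
Proof.
move=> mf mg; have := measurable_fun_ltr mf mg.
by move=> /(_ measurableT [set true] I); rewrite setTI.
Qed.

End ProbabilityValues.

(** * Tails of laws on the real line *)

Section Tail.
Context (R : realType).
Implicit Types (F : probability R R) (x y : R).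

Lemma measurable_ray x : measurable [set y : R | x < y].
Proof. exact: measurable_set_lt. Qed.

Lemma tailE F x : tail F x = pr F [set y | x < y].
Proof.
rewrite /tail /pr; congr (fine (F _)); apply/seteqP.
by split=> y /=; rewrite in_itv/= andbT.
Qed.

Lemma tail_ge0 F x : 0 <= tail F x.
Proof. by rewrite tailE pr_ge0. Qed.

Lemma tail_le1 F x : tail F x <= 1.
Proof. by rewrite tailE; apply: pr_le1; exact: measurable_ray. Qed.

Lemma tail_le F x y : x <= y -> tail F y <= tail F x.
Proof.
move=> xy; rewrite !tailE; apply: pr_le; try exact: measurable_ray.
by move=> z /= yz; exact: le_lt_trans yz.
Qed.

(** The identity has law [F] under [F]; through it the limit at infinity and the right-continuity of
    [ccdf] carry over to [tail]. *)
Lemma tail_is_ccdf F :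
  exists X : {RV F >-> R}, forall x, ccdf X x = (tail F x)%:E.
Proof.
pose idR : R -> R := idfun.
pose idM := isMeasurableFun.Build _ _ R R idR (@measurable_id _ _ setT).
pose X : {mfun R >-> R} := HB.pack idR idM.
by exists X => x; rewrite /tail fineK// fin_num_measure.
Qed.

Lemma tail_cvg0 F (e : R) : 0 < e -> \forall x \near +oo, tail F x <= e.
Proof.
have [X XE] := tail_is_ccdf F.
move=> e0; have /fine_cvgP[_ /cvgrPdist_le/(_ e e0)] := cvg_ccdfy0 X.
apply: filterS => x /=; rewrite XE sub0r normrN; apply: le_trans.
exact: ler_norm.
Qed.

Lemma tail_right_cvg F x (e : R) : 0 < e ->
  \forall y \near x^'+, tail F x - e <= tail F y.
Proof.
have [X XE] := tail_is_ccdf F.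
move=> e0; have := @ccdf_right_continuous _ _ _ _ X x.
rewrite XE => /fine_cvgP[_ /cvgrPdist_le/(_ e e0)].
by apply: filterS => y /=; rewrite XE ler_norml => /andP[_]/=; lra.
Qed.

Lemma tail_convolution F x :
  tail (convolution F F) x = pr (F \x F)%E [set z | x < z.1 + z.2].
Proof.
rewrite /tail /convolution /pushforward /pr; congr (fine (_ _)); apply/seteqP.
by split=> y /=; rewrite in_itv/= andbT.
Qed.

Lemma measurable_sum_gt x : measurable [set z : R * R | x < z.1 + z.2].
Proof. by apply: measurable_set_lt => //; exact: measurable_funD. Qed.

Lemma pr_prod (P Q : probability R R) (A B : set R) :
  measurable A -> measurable B ->
  pr (P \x Q)%E (A `*` B) = pr P A * pr Q B.
Proof.
move=> mA mB; apply: EFin_inj; rewrite -prK; last exact: measurableX.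
by rewrite EFinM -!prK//; exact: product_measure1E.
Qed.

End Tail.

(** * Subexponential laws *)

Section Subexponential.
Context (R : realType).
Implicit Types (F : probability R R) (x y t K : R).

(** The part of a large sum that is not due to a single large term; its negligibility is how
    subexponentiality enters. *)
Definition joint_excess F K t : R :=
  pr (F \x F)%E [set z | [/\ K < z.1, K < z.2 & t < z.1 + z.2]].

Lemma measurable_joint_excess K t :
  measurable [set z : R * R | [/\ K < z.1, K < z.2 & t < z.1 + z.2]].
Proof.
rewrite (_ : mkset _ = ([set y | K < y] `*` [set y | K < y]) `&`
  [set z | t < z.1 + z.2]); last first.
  by apply/seteqP; split=> z /= => [[? ? ?]|[[? ?] ?]].
apply: measurableI; last exact: measurable_sum_gt.
by apply: measurableX; exact: measurable_ray.
Qed.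

Lemma pr_between F x : F `]-oo, 0[%classic = 0%E -> 0 <= x ->
  pr F [set y | 0 <= y <= x] = 1 - tail F x.
Proof.
move=> F0 x0; rewrite tailE -prC; last exact: measurable_ray.
have m0 : measurable (`]-oo, 0[%classic : set R) by [].
rewrite (_ : [set y | 0 <= y <= x] = (~` [set y | x < y]) `\` `]-oo, 0[%classic).
  rewrite -[RHS](_ : pr F ((~` [set y | x < y]) `\` `]-oo, 0[%classic)
    + pr F ((~` [set y | x < y]) `&` `]-oo, 0[%classic) = _); last first.
    rewrite -prU//.
    - by rewrite setUC setUIDK.
    - by apply: measurableD => //; apply: measurableC; exact: measurable_ray.
    - by apply: measurableI => //; apply: measurableC; exact: measurable_ray.
    - by apply/seteqP; split => y //= [[_ ?] [_ ?]].
  rewrite [X in _ + X](_ : _ = 0) ?addr0//; apply/eqP.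
  rewrite eq_le pr_ge0 andbT (le_trans (pr_le _ _ m0 _)) ?/pr ?F0//.
  by apply: measurableI => //; apply: measurableC; exact: measurable_ray.
apply/seteqP; split=> y /=; rewrite in_itv/=.
  by move=> /andP[y0 yx]; split; apply/negP; rewrite -leNgt.
by move=> [/negP + /negP]; rewrite -!leNgt => -> ->.
Qed.

(** The event of a sum above [t] has three disjoint parts: one coordinate exceeds [t] while the
    other lies in [[0, K]], in either order, or both exceed [K]. *)
Lemma convolution_tail_ge F K t : F `]-oo, 0[%classic = 0%E -> 0 <= K <= t ->
  2 * (1 - tail F K) * tail F t + joint_excess F K t <=
  tail (convolution F F) t.
Proof.
move=> F0 /andP[K0 Kt]; rewrite tail_convolution /joint_excess.
set S := [set z | _]; pose A := [set y | t < y]; pose N := [set y | 0 <= y <= K].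
have mA : measurable A by exact: measurable_ray.
have mN : measurable N.
  have -> : N = `[0, K]%classic by apply/seteqP; split => y; rewrite /N/= in_itv.
  exact: measurable_itv.
have mS : measurable S by exact: measurable_joint_excess.
have -> : 2 * (1 - tail F K) * tail F t =
    pr (F \x F)%E (A `*` N) + pr (F \x F)%E (N `*` A).
  by rewrite !pr_prod// /A -tailE /N pr_between//; ring.
have mAN : measurable (A `*` N) by exact: measurableX.
have mNA : measurable (N `*` A) by exact: measurableX.
rewrite -prU//; last first.
  apply/seteqP; split=> -[u v]//=; rewrite /A /N/= => -[[tu] /andP[_ vK]].
  by move=> [/andP[_ uK] tv]; have := lt_le_trans tu (le_trans uK Kt); rewrite ltxx.
rewrite -prU//; first last.
- apply/seteqP; split=> -[u v]//=; rewrite /A /N/=.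
  move=> [[[_ /andP[_ vK]]|[/andP[_ uK] _]] [Ku Kv _]].
    by have := lt_le_trans Kv vK; rewrite ltxx.
  by have := lt_le_trans Ku uK; rewrite ltxx.
- exact: measurableU.
apply: pr_le.
- by apply: measurableU => //; exact: measurableU.
- exact: measurable_sum_gt.
- move=> [u v] /=; rewrite /A /N /S /=.
  move=> [[[tu /andP[v0 _]]|[/andP[u0 _] tv]]|[]//].
    by rewrite ltr_wpDr.
  by rewrite ltr_wpDl.
Qed.

(** In [convolution_tail_ge] the single large terms already account for almost all of the
    convolution tail: with [tail F K <= e / 4] at most [(2 + e / 4) - 2 * (1 - e / 4)] times
    [tail F t] is left. *)
Lemma joint_excess_small F (e : R) : subexponential F -> 0 < e ->
  exists2 K, 0 < K & \forall t \near +oo, joint_excess F K t <= e * tail F t.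
Proof.
move=> [F0 Fpos /cvgrPdist_le F2] e0.
have e4 : 0 < e / 4 by rewrite divr_gt0.
have [K [K0 FK]] : exists K, 0 < K /\ tail F K <= e / 4.
  near (pinfty_nbhs R) => K; exists K; split; near: K.
    exact: nbhs_pinfty_gt.
  exact: tail_cvg0.
exists K => //; near=> t.
have Kt : K <= t by near: t; apply: nbhs_pinfty_ge; rewrite num_real.
have := @convolution_tail_ge F K t F0; rewrite (ltW K0) Kt => /(_ isT) h.
have : `|2 - tail (convolution F F) t / tail F t| <= e / 4.
  by near: t; exact: F2.
rewrite ler_norml => /andP[+ _].
rewrite lerBrDl -lerBrDr opprK ler_pdivrMr// => h2.
have Ft := Fpos t.
have : tail F K * tail F t <= e / 4 * tail F t by rewrite ler_pM2r.
nra.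
Unshelve. all: by end_near. Qed.

End Subexponential.

(** * Insensitivity of the tail to shifts of order [a x] *)

Section InsensitiveTail.
Context (R : realType) (F : probability R R) (a : R -> R).
Hypothesis F_gt0 : forall x : R, 0 < tail F x.
Hypothesis a_gt0 : forall x : R, 0 < x -> 0 < a x.
Hypothesis a_nd : forall x y : R, 0 < x -> x <= y -> a x <= a y.
Hypothesis xa_nd : forall x y : R, 0 < x -> x <= y -> x / a x <= y / a y.
Hypothesis xa_cvg : x / a x @[x --> +oo] --> +oo.
Hypothesis F_tail : tail F (x - a x) / tail F x @[x --> +oo] --> (1 : R).

Let ratio_le (x y : R) : 0 < x -> x <= y -> x * a y <= y * a x.
Proof.
move=> x0 xy; have y0 := lt_le_trans x0 xy.
by have := xa_nd x0 xy; rewrite ler_pdivrMr ?a_gt0// mulrAC ler_pdivlMr ?a_gt0.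
Qed.

(** The shifted point [s'] stays above [s / 2], where monotonicity of [x / a x] yields
    [a s' >= a s / 2]; hence each use of the hypothesis at [s'] gains one more half step. *)
Lemma tail_shift_half (n : nat) (e : R) : 0 < e ->
  \forall s \near +oo, tail F (s - n%:R / 2 * a s) <= (1 + e) * tail F s.
Proof.
elim: n e => [|n IH] e e0.
  by apply: nearW => s; rewrite mul0r mul0r subr0 ler_peMl ?tail_ge0// lerDl ltW.
(* One factor [1 + e'] is for the induction hypothesis, one for the last half step. *)
pose e' := Num.min (e / 3) 1.
have e'0 : 0 < e' by rewrite lt_min ltr01 andbT divr_gt0.
have e'e : (1 + e') * (1 + e') <= 1 + e.
  have : e' <= e / 3 by rewrite ge_min lexx.
  have : e' <= 1 by rewrite ge_min lexx orbT.
  nra.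
have [s0 [_ Hs0]] : \forall s \near +oo, tail F (s - a s) <= (1 + e') * tail F s.
  move/cvgrPdist_le : F_tail => /(_ e' e'0); apply: filterS => s.
  rewrite ler_norml => /andP[+ _].
  by rewrite lerBrDl -lerBrDr opprK ler_pdivrMr.
near=> s.
have s_gt0 : 0 < s by near: s; exact: nbhs_pinfty_gt.
have s_gts0 : 2 * s0 < s by near: s; apply: nbhs_pinfty_gt; exact: num_real.
(* This keeps the total shift at most [s / 2]. *)
have ns : n%:R <= s / a s.
  by near: s; move/cvgryPge : xa_cvg; apply.
have as0 := a_gt0 s_gt0.
move: ns; rewrite ler_pdivlMr// => ns.
set s' := s - n%:R / 2 * a s.
have ss' : s / 2 <= s' by rewrite /s'; lra.
have s's : s' <= s by rewrite /s' gerBl mulr_ge0 ?divr_ge0// ltW.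
have s'0 : 0 < s' by lra.
have as' : a s / 2 <= a s'.
  have := ratio_le s'0 s's.
  have := a_gt0 s'0.
  nra.
have h1 : tail F s' <= (1 + e') * tail F s.
  by rewrite /s'; near: s; exact: IH.
have h2 : tail F (s' - a s') <= (1 + e') * tail F s'.
  by apply: Hs0; lra.
apply: (@le_trans _ _ (tail F (s' - a s'))).
  have s'E : s' = s - n%:R / 2 * a s by [].
  by apply: tail_le; clearbody s'; rewrite -natr1; lra.
apply: (le_trans h2); apply: (@le_trans _ _ ((1 + e') * ((1 + e') * tail F s))).
  by rewrite ler_pM2l//; lra.
by rewrite mulrA ler_pM2r.
Unshelve. all: by end_near. Qed.

Lemma tail_shift (M e : R) : 0 < e ->
  \forall s \near +oo, tail F (s - M * a s) <= (1 + e) * tail F s.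
Proof.
move=> e0; pose n := (Num.truncn `|2 * M|).+1.
have Mn : M <= n%:R / 2.
  have : `|2 * M| < n%:R by rewrite /n truncnS_gt.
  have := ler_norm (2 * M); lra.
near=> s.
have s_gt0 : 0 < s by near: s; exact: nbhs_pinfty_gt.
apply: (@le_trans _ _ (tail F (s - n%:R / 2 * a s))).
  by apply: tail_le; rewrite lerD2l lerN2 ler_wpM2r// ltW ?a_gt0.
by near: s; exact: tail_shift_half.
Unshelve. all: by end_near. Qed.

(** The conditional tail of [V1 Y1 + V2 Y2] given [Y1 = y1] and [Y2 = y2], where [V1] and [V2] have
    law [F]. *)
Definition scaled_sum_tail (x y1 y2 : R) : R :=
  pr (F \x F)%E [set z | x < z.1 * y1 + z.2 * y2].

Lemma measurable_scaled_sum (x y1 y2 : R) :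
  measurable [set z : R * R | x < z.1 * y1 + z.2 * y2].
Proof.
apply: measurable_set_lt => //; apply: measurable_funD.
  by apply: measurable_funM => //; exact: measurable_fst.
by apply: measurable_funM => //; exact: measurable_snd.
Qed.

(** For [y >= 1], monotonicity of [x / a x] gives [a (x / y) >= a x / y]; for [y < 1], monotonicity
    of [a] gives [a (x / y) >= a x]. *)
Let a_scale (c x y : R) : 0 < c <= 1 -> 0 < x -> c <= y ->
  c * a x / y <= a (x / y).
Proof.
move=> /andP[c0 c1] x0 cy; have y0 := lt_le_trans c0 cy.
have s0 : 0 < x / y by rewrite divr_gt0.
have ax := a_gt0 x0; have as0 := a_gt0 s0.
have [y1|y1] := leP 1 y.
  have sx : x / y <= x by rewrite ler_pdivrMr// ler_peMr// ltW.
  have := ratio_le s0 sx; rewrite mulrAC -mulrA [X in _ <= X]mulrC.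
  rewrite (mulrC x) ler_pM2r// => h.
  apply: le_trans h; rewrite -mulrA ler_piMl// mulr_ge0 ?invr_ge0// ltW//.
have sx : x <= x / y by rewrite ler_pdivlMr// ler_piMr// ltW.
apply: (le_trans _ (a_nd x0 sx)); rewrite ler_pdivrMr//; nra.
Qed.

(** The bound is uniform in [y1] and [y2] because [x / y1], [x / y2] and [x / m] are all at least
    [x / a x], which tends to infinity and so passes the thresholds [t0] and [s0]. *)
Lemma scaled_sum_tail_le (c e : R) : subexponential F -> 0 < c <= 1 -> 0 < e ->
  \forall x \near +oo, forall y1 y2 : R, c <= y1 <= a x -> c <= y2 <= a x ->
    scaled_sum_tail x y1 y2 <= (1 + e) * (tail F (x / y1) + tail F (x / y2)).
Proof.
move=> FS c01 e0; have e2 : 0 < e / 2 by rewrite divr_gt0.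
have /andP[c0 c1] := c01.
have [K K0 [t0 [_ Ht0]]] := joint_excess_small FS e2.
have [s0 [_ Hs0]] := tail_shift (K / c) e2.
near=> x => y1 y2 /andP[cy1 y1a] /andP[cy2 y2a].
have x0 : 0 < x by near: x; exact: nbhs_pinfty_gt.
have ax := a_gt0 x0.
have xt0 : t0 < x / a x by near: x; move/cvgryPgt : xa_cvg; exact.
have xs0 : s0 < x / a x by near: x; move/cvgryPgt : xa_cvg; exact.
set m := Num.max y1 y2.
have y10 := lt_le_trans c0 cy1; have y20 := lt_le_trans c0 cy2.
have m0 : 0 < m by rewrite lt_max y10.
have ma : m <= a x by rewrite ge_max y1a.
have xa y : 0 < y -> y <= a x -> x / a x <= x / y.
  by move=> y0 ya; rewrite ler_pM2l// lef_pV2// posrE.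
have shift y : c <= y -> y <= a x -> tail F ((x - K * m) / y) <=
    (1 + e / 2) * tail F (x / y).
  move=> cy ya; have y0 := lt_le_trans c0 cy.
  apply: (@le_trans _ _ (tail F (x / y - K / c * a (x / y)))); last first.
    by apply: Hs0; exact: lt_le_trans (xa _ y0 ya).
  apply: tail_le; rewrite mulrBl lerD2l lerN2.
  apply: (@le_trans _ _ (K / c * (c * a x / y))).
    rewrite (_ : K / c * (c * a x / y) = K * a x / y); last by field; lra.
    by rewrite ler_pM2r ?invr_gt0// ler_pM2l.
  by rewrite ler_pM2l ?divr_gt0// a_scale.
have mscaled x' y : measurable [set z : R | x' < z * y].
  by apply: measurable_set_lt => //; exact: measurable_funM.
have prscaled x' y : 0 < y -> pr F [set z : R | x' < z * y] = tail F (x' / y).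
  by move=> y0; rewrite tailE; congr pr; apply/seteqP; split=> z /=;
    rewrite ltr_pdivrMr.
(* [A1] and [A2] are the events of a single large term, [A3] that of a joint excess. *)
pose A1 := [set z : R | x - K * m < z * y1] `*` [set: R].
pose A2 := [set: R] `*` [set z : R | x - K * m < z * y2].
pose A3 := [set z : R * R | [/\ K < z.1, K < z.2 & x / m < z.1 + z.2]].
have mA1 : measurable A1 by exact: measurableX.
have mA2 : measurable A2 by exact: measurableX.
have mA3 : measurable A3 by exact: measurable_joint_excess.
have sub : scaled_sum_tail x y1 y2 <= pr (F \x F)%E (A1 `|` A2 `|` A3).
  apply: pr_le; first exact: measurable_scaled_sum.
    by apply: measurableU => //; exact: measurableU.
  move=> [u v] /= xuv.
  have [h1|h1] := ltP (x - K * m) (u * y1); first by do 2 left; split.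
  have [h2|h2] := ltP (x - K * m) (v * y2); first by left; right; split.
  have y1m : y1 <= m by rewrite le_max lexx.
  have y2m : y2 <= m by rewrite le_max lexx orbT.
  (* As [v * y2 <= x - K * m], the other term exceeds [K * m >= K * y1]; symmetrically for [v]. *)
  have Ku : K < u by rewrite -(ltr_pM2r y10); nra.
  have Kv : K < v by rewrite -(ltr_pM2r y20); nra.
  by right; split => //=; rewrite ltr_pdivrMr//; nra.
apply: (le_trans sub); apply: (le_trans (prU_le _ _ _)) => //.
  exact: measurableU.
have h12 : pr (F \x F)%E (A1 `|` A2) <=
    (1 + e / 2) * (tail F (x / y1) + tail F (x / y2)).
  apply: (le_trans (prU_le _ _ _)) => //.
  rewrite !pr_prod//; [|exact: measurableT..].
  by rewrite prT mulr1 mul1r !prscaled// mulrDr lerD// shift.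
have h3 : pr (F \x F)%E A3 <= e / 2 * (tail F (x / y1) + tail F (x / y2)).
  apply: le_trans (_ : e / 2 * tail F (x / m) <= _).
    by apply: Ht0; exact: lt_le_trans (xa _ m0 ma).
  (* The maximum [m] is [y1] or [y2], so [tail F (x / m)] is one of the two summands. *)
  rewrite ler_pM2l// /m; case: (leP y1 y2) => _.
    by rewrite lerDr tail_ge0.
  by rewrite lerDl tail_ge0.
lra.
Unshelve. all: by end_near. Qed.

End InsensitiveTail.

(** * Laws of products *)

Section ProductLaw.
Context (R : realType) (F G H : probability R R).
(* The factor multiplying V comes first in [G \x F]: by definition this product
   measure integrates over G the F-measure of the sections at fixed y. *)
Hypothesis HE : forall A : set R, measurable A ->
  H A = (G \x F)%E [set z | A (z.2 * z.1)].

Local Open Scope ereal_scope.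

Let mul_swap (z : R * R) : R := (z.2 * z.1)%R.

Let measurable_mul_swap : measurable_fun setT mul_swap.
Proof. by apply: measurable_funM; [exact: measurable_snd|exact: measurable_fst]. Qed.

Lemma tail_product_law (x : R) :
  tail H x = pr (G \x F) [set z | (x < z.2 * z.1)%R].
Proof. by rewrite tailE /pr HE//; exact: measurable_ray. Qed.

Let measurable_scaled_sum3 (x y1 : R) :
  measurable [set p : (R * R) * R | (x < p.1.1 * y1 + p.2 * p.1.2)%R].
Proof.
apply: measurable_set_lt => //; apply: measurable_funD.
  apply: measurable_funM => //.
  exact: measurableT_comp measurable_fst measurable_fst.
exact: measurable_funM measurable_snd
  (measurableT_comp measurable_snd measurable_fst).
Qed.

Let measurable_scaled_sum4 (x : R) : measurable
  [set p : (R * R) * (R * R) | (x < p.2.1 * p.1.1 + p.2.2 * p.1.2)%R].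
Proof.
apply: measurable_set_lt => //; apply: measurable_funD.
  exact: measurable_funM (measurableT_comp measurable_fst measurable_snd)
    (measurableT_comp measurable_fst measurable_fst).
exact: measurable_funM (measurableT_comp measurable_snd measurable_snd)
  (measurableT_comp measurable_snd measurable_fst).
Qed.

Let measurable_scaled_sum_tail (x : R) : measurable_fun setT
  (fun y : R * R => (F \x F) [set z | (x < z.1 * y.1 + z.2 * y.2)%R]).
Proof.
have := measurable_fun_xsection (F \x F : probability (R * R)%type R)
  (measurable_scaled_sum4 x).
by apply: eq_measurable_fun => y _ /=; congr (_ _); apply/seteqP; split=> z;
  rewrite /xsection/= inE.
Qed.

(** Each factor [H] is replaced by the image of [G \x F] under multiplication, and Tonelli moves the
    integrals over [G] outside those over [F]. *)
Lemma convolution_product_law (x : R) :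
  (H \x H) [set z | (x < z.1 + z.2)%R] =
  \int[G]_y1 \int[G]_y2 (F \x F) [set z | (x < z.1 * y1 + z.2 * y2)%R].
Proof.
set S := [set z : R * R | _].
have mS : measurable S by exact: measurable_sum_gt.
rewrite [LHS](_ : _ = \int[H]_z H (xsection S z))//.
have mh : measurable_fun setT (fun z => H (xsection S z)).
  exact: measurable_fun_xsection.
pose mulI := isMeasurableFun.Build _ _ (R * R)%type R mul_swap measurable_mul_swap.
pose mulM : {mfun (R * R)%type >-> R} := HB.pack mul_swap mulI.
transitivity (\int[pushforward (G \x F) mulM]_z H (xsection S z)).
  by apply: eq_measure_integral => A mA _; exact: HE.
rewrite ge0_integral_pushforward//= preimage_setT.
rewrite fubini_tonelli1//=; last exact: (measurableT_comp mh measurable_mul_swap).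
apply: eq_integral => y1 _; rewrite /fubini_F/=.
(* [k (v, y2)] leaves only the second [F]-variable random. *)
pose k (p : R * R) := F [set v : R | (x < p.1 * y1 + v * p.2)%R].
have mk : measurable_fun setT k.
  have := measurable_fun_xsection F (measurable_scaled_sum3 x y1).
  apply: eq_measurable_fun => y _ /=; rewrite /k; congr (F _).
  by apply/seteqP; split=> z; rewrite /xsection/= inE.
transitivity (\int[F]_v \int[G]_y2 k (v, y2)).
  apply: eq_integral => v _; rewrite HE; last exact: measurable_xsection.
  rewrite [LHS](_ : _ = \int[G]_y F (xsection
    [set z | xsection S (v * y1)%R (z.2 * z.1)%R] y))//.
  apply: eq_integral => y2 _; rewrite /k.
  suff -> : xsection [set z | xsection S (v * y1)%R (z.2 * z.1)%R] y2 =
    [set v0 | (x < v * y1 + v0 * y2)%R] by [].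
  by apply/seteqP; split=> z; rewrite /xsection/= !inE /=  inE.
rewrite fubini_tonelli//.
apply: eq_integral => y2 _; apply: eq_integral => v _; rewrite /k/=.
by congr (F _); apply/seteqP; split=> z; rewrite /xsection/= inE.
Qed.

(** A bound split between [y1] and [y2] integrates term by term, since [G] has mass one. *)
Lemma convolution_product_law_le (u : R -> \bar R) (x : R) :
  measurable_fun setT u -> (forall y, 0 <= u y) ->
  (forall y1 y2 : R,
    (F \x F) [set z | (x < z.1 * y1 + z.2 * y2)%R] <= u y1 + u y2) ->
  (H \x H) [set z | (x < z.1 + z.2)%R] <= \int[G]_y u y + \int[G]_y u y.
Proof.
move=> mu u0 le_u; rewrite convolution_product_law.
have intC (r : \bar R) : 0 <= r -> \int[G]_y r = r.
  move=> r0; rewrite integral_cst// -[RHS]mule1; congr (_ * _).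
  exact: probability_setT.
have step y1 : \int[G]_y2 (F \x F) [set z | (x < z.1 * y1 + z.2 * y2)%R] <=
    u y1 + \int[G]_y u y.
  apply: (@le_trans _ _ (\int[G]_y2 (u y1 + u y2))).
    apply: ge0_le_integral => //.
    - exact: (measurableT_comp (measurable_scaled_sum_tail x)
        (measurable_pair1 y1)).
    - exact: emeasurable_funD.
  by rewrite ge0_integralD// intC.
apply: (@le_trans _ _ (\int[G]_y1 (u y1 + \int[G]_y u y))).
  apply: ge0_le_integral => //.
  - by move=> y _; exact: integral_ge0.
  - exact: (measurable_fun_fubini_tonelli_F (m2 := G) _
      (measurable_scaled_sum_tail x)).
  - exact: emeasurable_funD.
rewrite ge0_integralD ?intC//; first exact: integral_ge0.
by move=> *; exact: integral_ge0.
Qed.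

End ProductLaw.

(** * Subexponentiality of the product law *)

Section ClineSamorodnitsky.
Context (R : realType).

Lemma pr_neg (F : probability R R) : F `]-oo, 0[%classic = 0%E ->
  pr F [set y | y < 0] = 0.
Proof.
move=> F0; rewrite /pr (_ : [set y | y < 0] = `]-oo, 0[%classic) ?F0//.
Qed.

Variables (F G H : probability R R) (a : R -> R).
Hypothesis HE : forall A : set R, measurable A ->
  H A = (G \x F)%E [set z | A (z.2 * z.1)].
Hypothesis FS : subexponential F.
Hypothesis G_gt0 : tail G 0 = 1.

(** The left side is the mass of the rectangle [Y > c], [V > x], on which [V Y > x c]. *)
Lemma tail_product_ge (x c : R) : 0 <= x -> 0 < c ->
  tail F x * tail G c <= tail H (x * c).
Proof.
move=> x0 c0; rewrite (tail_product_law HE) mulrC !tailE -pr_prod;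
  try exact: measurable_ray.
apply: pr_le; first by apply: measurableX; exact: measurable_ray.
  apply: measurable_set_lt => //.
  by apply: measurable_funM; [exact: measurable_snd|exact: measurable_fst].
by move=> [y v] /= [cy xv]; apply: ltr_pM => //; exact: ltW.
Qed.

Lemma tail_product_gt0 (x : R) : 0 < tail H x.
Proof.
have [_ F_gt0 _] := FS.
have half : (0 : R) < 2^-1 by rewrite invr_gt0.
(* Right-continuity at [0] and [tail G 0 = 1] give a [c > 0] with [tail G c >= 1 / 2]. *)
near (0 : R)^'+ => c.
have c0 : 0 < c by near: c; exact: nbhs_right_gt.
have Gc : tail G 0 - 2^-1 <= tail G c by near: c; exact: tail_right_cvg.
set y := Num.max x 0.
have yc : 0 <= y / c by rewrite divr_ge0 ?(ltW c0)// le_max lexx orbT.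
have := tail_product_ge yc c0; rewrite divfK ?gt_eqF// => h.
have xy : x <= y by rewrite le_max lexx.
apply: (lt_le_trans _ (tail_le H xy)); apply: (lt_le_trans _ h).
by rewrite mulr_gt0//; move: Gc; rewrite G_gt0; lra.
Unshelve. all: by end_near. Qed.

Lemma product_law_ge0 : H `]-oo, 0[%classic = 0%E.
Proof.
have [/pr_neg F0 _ _] := FS.
have mN : measurable [set v : R | v < 0] by exact: measurable_set_lt.
have mP : measurable (~` [set y : R | 0 < y]).
  by apply: measurableC; exact: measurable_ray.
have mPT : measurable ((~` [set y : R | 0 < y]) `*` [set: R]).
  exact: measurableX.
have mTN : measurable ([set: R] `*` [set v : R | v < 0]) by exact: measurableX.
rewrite (@prK _ _ _ H)//; congr EFin; rewrite /pr HE//.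
rewrite -/(pr (G \x F)%E [set z | (`]-oo, 0[)%classic (z.2 * z.1)]).
apply/eqP; rewrite eq_le pr_ge0 andbT.
apply: (@le_trans _ _ (pr (G \x F)%E
  ((~` [set y : R | 0 < y]) `*` setT `|` setT `*` [set v : R | v < 0]))).
  apply: pr_le; last 2 first.
  - exact: measurableU.
  - move=> [y v] /=; rewrite in_itv/= => vy.
    have [v0|v0] := ltP v 0; [by right|left; split=> //=].
    by apply/negP; rewrite -leNgt; nra.
  have -> : [set z : R * R | (`]-oo, 0[)%classic (z.2 * z.1)] =
      [set z | z.2 * z.1 < 0].
    by apply/seteqP; split => z /=; rewrite in_itv.
  apply: measurable_set_lt => //.
  by apply: measurable_funM; [exact: measurable_snd|exact: measurable_fst].
apply: (le_trans (prU_le _ _ _)) => //.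
rewrite !pr_prod//; try exact: measurableT.
rewrite F0 mulr0 addr0 prC; last exact: measurable_ray.
by rewrite -tailE G_gt0 subrr mul0r.
Qed.

(** Outside the null event of a negative coordinate the weighted sum is monotone in the weights. *)
Lemma scaled_sum_tail_max (x y1 y2 m1 m2 : R) : y1 <= m1 -> y2 <= m2 ->
  scaled_sum_tail F x y1 y2 <= scaled_sum_tail F x m1 m2.
Proof.
move=> ym1 ym2.
have [/pr_neg F0 _ _] := FS.
pose N := [set y : R | y < 0].
have mN : measurable N by exact: measurable_set_lt.
have mNT : measurable (N `*` [set: R]) by exact: measurableX.
have mTN : measurable ([set: R] `*` N) by exact: measurableX.
have mS := measurable_scaled_sum x m1 m2.
apply: (@le_trans _ _ (pr (F \x F)%E ([set z | x < z.1 * m1 + z.2 * m2]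
    `|` (N `*` setT `|` setT `*` N)))).
  apply: pr_le; first exact: measurable_scaled_sum.
    by apply: measurableU => //; exact: measurableU.
  move=> [u v] /= xuv.
  have [u0|u0] := ltP u 0; first by right; left.
  have [v0|v0] := ltP v 0; first by right; right.
  by left; apply: (lt_le_trans xuv); rewrite lerD// ler_wpM2l.
apply: (le_trans (prU_le _ _ _)) => //; first exact: measurableU.
rewrite gerDl; apply: (le_trans (prU_le _ _ _)) => //.
rewrite !pr_prod//; try exact: measurableT.
by rewrite F0 mul0r mulr0 addr0.
Qed.

Let measurable_max_mul (x c : R) :
  measurable [set z : R * R | x < z.2 * Num.max z.1 c].
Proof.
apply: measurable_set_lt => //; apply: measurable_funM.
  exact: measurable_snd.
apply: measurable_maxr => //; exact: measurable_fst.
Qed.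

(** If [Y >= c] the maximum is [Y]; otherwise it is [c], and independence separates [Y <= c] from
    [V > x / c]. *)
Lemma pr_max_le (x c : R) : 0 < c -> 0 <= x ->
  pr (G \x F)%E [set z | x < z.2 * Num.max z.1 c] <=
  tail H x + (1 - tail G c) * tail F (x / c).
Proof.
move=> c0 x0; rewrite (tail_product_law HE) [tail G c]tailE -prC; last first.
  exact: measurable_ray.
rewrite tailE -pr_prod; [|by apply: measurableC; exact: measurable_ray
  |exact: measurable_ray].
have mS : measurable [set z : R * R | x < z.2 * z.1].
  apply: measurable_set_lt => //.
  by apply: measurable_funM; [exact: measurable_snd|exact: measurable_fst].
have mX : measurable ((~` [set y | c < y]) `*` [set y : R | x / c < y]).
  apply: measurableX; last exact: measurable_ray.
  by apply: measurableC; exact: measurable_ray.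
apply: le_trans (prU_le _ _ _) => //; apply: pr_le => //.
  exact: measurableU.
move=> [y v] /=; case: (ltP y c) => yc xv; last by left.
by right; split => /=; [apply/negP; rewrite -leNgt ltW|rewrite ltr_pdivrMr].
Qed.

Let domin (x c e y : R) : \bar R :=
  ((\1_[set y | a x < y] y)%:E +
   (1 + e)%:E * F [set v | (x < v * Num.max y c)%R])%E.

(** The sum of [domin] at [y1] and at [y2] bounds the conditional tail for all weights; it is
    integrated over [G], and [pr_max_le] bounds the result. *)
Lemma convolution_product_tail_le (x c e : R) : 0 <= x -> 0 < c -> 0 < e ->
  c <= a x ->
  (forall y1 y2 : R, c <= y1 <= a x -> c <= y2 <= a x ->
    scaled_sum_tail F x y1 y2 <= (1 + e) * (tail F (x / y1) + tail F (x / y2))) ->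
  tail (convolution H H) x <= 2 * (tail G (a x) + (1 + e) *
     (tail H x + (1 - tail G c) * tail F (x / c))).
Proof.
move=> x0 c0 e0 cax bound.
have e1 : (0 <= (1 + e)%:E)%E by rewrite lee_fin; lra.
have mF : measurable_fun setT (fun y : R => F [set v | x < v * Num.max y c]).
  have := measurable_fun_xsection F (measurable_max_mul x c).
  apply: eq_measurable_fun => y _ /=; congr (F _).
  by apply/seteqP; split=> z; rewrite /xsection/= inE.
have mu1 : measurable_fun setT (fun y : R => (\1_[set y | a x < y] y)%:E : \bar R).
  apply/measurable_EFinP; apply: measurable_indic; exact: measurable_ray.
have mu2 : measurable_fun setT
    (fun y : R => (1 + e)%:E * F [set v | (x < v * Num.max y c)%R])%E.
  exact: measurable_funeM.
have mu : measurable_fun setT (domin x c e) by exact: emeasurable_funD.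
have u0 y : (0 <= domin x c e y)%E by rewrite adde_ge0// mule_ge0.
have le_u y1 y2 : ((F \x F) [set z | (x < z.1 * y1 + z.2 * y2)%R] <=
    domin x c e y1 + domin x c e y2)%E.
  rewrite [leLHS](@prK _ _ _ (F \x F : probability (R * R)%type R)%E); last first.
    exact: measurable_scaled_sum.
  have big y y' : a x < y -> (1 <= domin x c e y + domin x c e y')%E.
    move=> axy; apply: (@le_trans _ _ (domin x c e y)); last by rewrite leeDl.
    by rewrite /domin indicE mem_set//= leeDl// mule_ge0.
  have le1 : ((scaled_sum_tail F x y1 y2)%:E <= 1)%E.
    by rewrite lee_fin pr_le1//; exact: measurable_scaled_sum.
  have [y1a|y1a] := ltP (a x) y1; first exact: le_trans le1 (big _ _ y1a).
  have [y2a|y2a] := ltP (a x) y2.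
    by apply: le_trans le1 _; rewrite addeC; exact: big.
  have dominE y : y <= a x ->
      domin x c e y = ((1 + e) * tail F (x / Num.max y c))%:E.
    move=> ya; rewrite /domin indicE memNset/= ?add0e; last first.
      by apply/negP; rewrite -leNgt.
    have m0 : 0 < Num.max y c by rewrite lt_max c0 orbT.
    rewrite EFinM; congr (_ * _)%E; rewrite tailE -prK; last exact: measurable_ray.
    by congr (F _); apply/seteqP; split=> v /=; rewrite ltr_pdivrMr.
  rewrite !dominE// -EFinD lee_fin -mulrDr.
  (* Raising both weights to at least [c] brings them into [[c, a x]], where [bound] applies. *)
  apply: (@le_trans _ _ (scaled_sum_tail F x (Num.max y1 c) (Num.max y2 c))).
    by apply: scaled_sum_tail_max; rewrite le_max lexx.
  by apply: bound; rewrite le_max lexx orbT/= ge_max cax andbT.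
have int_u : (\int[G]_y domin x c e y = (tail G (a x) +
    (1 + e) * pr (G \x F) [set z | (x < z.2 * Num.max z.1 c)%R])%:E)%E.
  rewrite ge0_integralD//=; last by move=> y _; rewrite mule_ge0.
  rewrite integral_indic//; last exact: measurable_ray.
  rewrite setIT ge0_integralZl//.
  rewrite [RHS]EFinD [in RHS]EFinM tailE -!prK//; last exact: measurable_ray.
  congr (_ + _ * _)%E; apply: eq_integral => y _; congr (F _).
  by apply/seteqP; split=> z; rewrite /xsection/= inE.
have := convolution_product_law_le HE mu u0 le_u.
rewrite int_u -EFinD [leLHS](@prK _ _ _ (H \x H : probability (R * R)%type R)%E);
  last exact: measurable_sum_gt.
rewrite lee_fin -tail_convolution => /le_trans; apply.
have : (1 + e) * pr (G \x F)%E [set z | x < z.2 * Num.max z.1 c] <=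
    (1 + e) * (tail H x + (1 - tail G c) * tail F (x / c)).
  by rewrite ler_pM2l; [exact: pr_max_le|lra].
by move=> h; rewrite [leRHS]mulr_natl mulr2n; apply: lerD; rewrite lerD2l.
Qed.

Hypothesis a_gt0 : forall x : R, 0 < x -> 0 < a x.
Hypothesis a_nd : forall x y : R, 0 < x -> x <= y -> a x <= a y.
Hypothesis a_cvg : a x @[x --> +oo] --> +oo.
Hypothesis xa_nd : forall x y : R, 0 < x -> x <= y -> x / a x <= y / a y.
Hypothesis xa_cvg : x / a x @[x --> +oo] --> +oo.
Hypothesis F_tail : tail F (x - a x) / tail F x @[x --> +oo] --> (1 : R).
Hypothesis G_tail : forall e : R, 0 < e ->
  \forall x \near +oo, tail G (a x) <= e * tail H x.

Theorem subexponential_product : subexponential H.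
Proof.
split; [exact: product_law_ge0|exact: tail_product_gt0|].
have [_ F_gt0 _] := FS.
apply/cvgrPdist_le => eta eta0.
(* The upper estimate will be [(2 + 8 * e) * tail H x]; [e <= 1] absorbs the squares of [e]. *)
pose e := Num.min 1 (eta / 8).
have e0 : 0 < e by rewrite lt_min ltr01 divr_gt0.
have e1 : e <= 1 by rewrite ge_min lexx.
have e8 : 8 * e <= eta.
  have : e <= eta / 8 by rewrite ge_min lexx orbT.
  lra.
(* Then [1 - tail G c <= e * tail G c]: replacing small [Y] by [c] costs a relative error of at most
   [e]. *)
have [c [c01 Gc]] : exists c, 0 < c <= 1 /\ 1 <= (1 + e) * tail G c.
  have e2 : 0 < e / 2 by rewrite divr_gt0.
  near (0 : R)^'+ => c; exists c; split.
    apply/andP; split; near: c; first exact: nbhs_right_gt.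
    by apply: nbhs_right_le.
  have : tail G 0 - e / 2 <= tail G c by near: c; exact: tail_right_cvg e2.
  rewrite G_gt0 => h; nra.
have /andP[c0 c1] := c01.
near=> x.
have x0 : 0 <= x by near: x; apply: nbhs_pinfty_ge; rewrite num_real.
have Hx := tail_product_gt0 x.
rewrite ler_norml; apply/andP; split.
  rewrite lerBrDl -lerBrDr opprK ler_pdivrMr//.
  have cax : c <= a x by near: x; move/cvgryPge : a_cvg; apply.
  have hx := convolution_product_tail_le x0 c0 e0 cax.
  apply: le_trans (hx _) _.
    near: x; exact: scaled_sum_tail_le.
  have h1 : tail G (a x) <= e * tail H x by near: x; exact: G_tail.
  have h2 : tail F (x / c) * tail G c <= tail H x.
    have xc : 0 <= x / c by rewrite divr_ge0// ltW.
    by have := tail_product_ge xc c0; rewrite divfK ?gt_eqF.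
  have h3 : (1 - tail G c) * tail F (x / c) <= e * tail H x.
    have Fc := F_gt0 (x / c).
    apply: (@le_trans _ _ (e * (tail F (x / c) * tail G c))).
      by rewrite mulrCA mulrC ler_pM2l//; lra.
    by rewrite ler_pM2l.
  have h4 : (1 + e) * (tail H x + (1 - tail G c) * tail F (x / c)) <=
      (1 + 3 * e) * tail H x.
    apply: (@le_trans _ _ ((1 + e) * ((1 + e) * tail H x))).
      by rewrite ler_pM2l; lra.
    by rewrite mulrA ler_pM2r//; nra.
  apply: (@le_trans _ _ ((2 + 8 * e) * tail H x)); first lra.
  by rewrite ler_pM2r//; lra.
(* For the lower estimate, [convolution_tail_ge] with [K := x] gives
   [2 * (1 - tail H x) * tail H x]. *)
have Hsmall : tail H x <= eta / 2 by near: x; apply: tail_cvg0; rewrite divr_gt0.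
rewrite lerBlDl -lerBlDr ler_pdivlMr//.
have := @convolution_tail_ge _ H x x product_law_ge0.
rewrite x0 lexx => /(_ isT) h.
have : 0 <= joint_excess H x x by exact: pr_ge0.
nra.
Unshelve. all: by end_near. Qed.

End ClineSamorodnitsky.

(** * Exponential bounds *)

Section ExponentialBounds.
Context (R : realType).
Implicit Types (f : R -> R) (h q c y : R).

Let steps h y : 0 < h -> 0 <= y ->
  exists2 k : nat, k%:R * h <= y & y < k.+1%:R * h.
Proof.
move=> h0 y0; exists (Num.truncn (y / h)).
  by rewrite -ler_pdivlMr// truncn_le// divr_ge0// ltW.
by rewrite -ltr_pdivrMr// truncnS_gt.
Qed.

Lemma expR_ln_pow (q : R) (k : nat) : 0 < q -> expR (k%:R * ln q) = q ^+ k.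
Proof. by move=> q0; rewrite expRM_natl lnK. Qed.

(** Comparison with the next grid point costs one factor [q]; the rate is [- ln q / h]. *)
Lemma geometric_lower f h q c : {homo f : x y /~ x <= y} -> 0 < h ->
  0 < q <= 1 -> 0 < c -> (forall k : nat, c * q ^+ k <= f (k%:R * h)) ->
  exists c' l : R, [/\ 0 < c', 0 <= l &
    forall y, 0 <= y -> c' * expR (- (l * y)) <= f y].
Proof.
move=> f_ni h0 /andP[q0 q1] c0 fk; exists (c * q), (- ln q / h).
have lq : ln q <= 0 by rewrite ln_le0.
split; [exact: mulr_gt0|by rewrite divr_ge0 ?oppr_ge0// ltW|].
move=> y y0; have [k ky yk] := steps h0 y0.
apply: le_trans (f_ni _ _ (ltW yk)); apply: le_trans (fk k.+1).
rewrite exprS -mulrA ler_pM2l// ler_pM2l// -expR_ln_pow// ler_expR.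
rewrite (_ : - (- ln q / h * y) = y / h * ln q); last by ring.
by rewrite ler_wnM2r// ler_pdivlMr.
Qed.

(** Comparison with the previous grid point costs one factor [1 / q]. *)
Lemma geometric_upper f h q c : {homo f : x y /~ x <= y} -> 0 < h ->
  0 < q < 1 -> 0 < c -> (forall k : nat, f (k%:R * h) <= c * q ^+ k) ->
  exists c' b : R, [/\ 0 < c', 0 < b &
    forall y, 0 <= y -> f y <= c' * expR (- (b * y))].
Proof.
move=> f_ni h0 /andP[q0 q1] c0 fk; exists (c / q), (- ln q / h).
have lq : ln q < 0 by rewrite ln_lt0// q0.
split; [exact: divr_gt0|by rewrite divr_gt0 ?oppr_gt0|].
move=> y y0; have [k ky yk] := steps h0 y0.
apply: le_trans (f_ni _ _ ky) _; apply: le_trans (fk k) _.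
rewrite -mulrA ler_pM2l// ler_pdivlMl// -exprS -expR_ln_pow// ler_expR.
rewrite (_ : - (- ln q / h * y) = y / h * ln q); last by ring.
by rewrite ler_wnM2r ?(ltW lq)// ler_pdivrMr// ltW.
Qed.

(** Since [a x >= 1] eventually, a unit step eventually reduces the tail by a factor of at most
    two. *)
Lemma insensitive_tail_lower (F : probability R R) (a : R -> R) :
  (forall x, 0 < tail F x) -> a x @[x --> +oo] --> +oo ->
  tail F (x - a x) / tail F x @[x --> +oo] --> (1 : R) ->
  exists c l : R, [/\ 0 < c, 0 <= l &
    forall x, 0 <= x -> c * expR (- (l * x)) <= tail F x].
Proof.
move=> F_gt0 a_cvg F_tail.
have [x0 [_ Hx0]] : \forall x \near +oo, tail F (x - 1) <= 2 * tail F x.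
  near=> x.
  have ax : 1 <= a x by near: x; move/cvgryPge : a_cvg; apply.
  apply: (@le_trans _ _ (tail F (x - a x))); first by apply: tail_le; lra.
  have : `|1 - tail F (x - a x) / tail F x| <= 1.
    by near: x; move/cvgrPdist_le : F_tail; apply.
  rewrite ler_norml => /andP[+ _].
  by rewrite lerBrDl -lerBrDr opprK ler_pdivrMr.
(* Starting at [m >= x0] makes the halving bound available at every step; [m >= 0] lets monotonicity
   return to [tail F x] at the end. *)
pose m := Num.max x0 0.
pose f y := tail F (m + y).
have f_ni : {homo f : x y /~ x <= y} by move=> x y xy; apply: tail_le; rewrite lerD2l.
have fk (k : nat) : f 0 * 2^-1 ^+ k <= f (k%:R * 1).
  elim: k => [|k IH]; first by rewrite expr0 !mulr1.
  have mk : x0 < m + k.+1%:R.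
    by rewrite ltr_pwDr// le_max lexx.
  move: (Hx0 _ mk) IH; rewrite /f !mulr1 exprS -natr1 addrA addrK => h IH.
  rewrite mulrCA; lra.
have h2 : 0 < (2^-1 : R) <= 1 by apply/andP; split; lra.
have [c [l [c0 l0 cl]]] := geometric_lower f_ni ltr01 h2 (F_gt0 (m + 0)) fk.
exists c, l; split=> // x xge0; apply: (le_trans (cl _ xge0)).
by apply: tail_le; rewrite lerDr le_max lexx orbT.
Unshelve. all: by end_near. Qed.

(** With [r] the square root of [x], eventually [b * a x >= (l + 1) * r]. Against the lower bound of
    order [expR (- (l * r))] for [tail H x] this leaves a surplus [expR (- r)], which absorbs all
    constants because [1 + r <= expR r]. *)
Lemma product_tail_dominates (F G H : probability R R) (a : R -> R)
    (c1 l1 c2 l2 c3 b : R) :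
  (forall A : set R, measurable A ->
    H A = (G \x F)%E [set z | A (z.2 * z.1)]) ->
  (forall x : R, 0 < x -> 0 < a x) ->
  Num.sqrt x / a x @[x --> +oo] --> (0 : R) ->
  0 < c1 -> 0 < c2 -> 0 < c3 -> 0 <= l1 -> 0 <= l2 -> 0 < b ->
  (forall x, 0 <= x -> c1 * expR (- (l1 * x)) <= tail F x) ->
  (forall x, 0 <= x -> c2 * expR (- (l2 * x)) <= tail G x) ->
  (forall x, 0 <= x -> tail G x <= c3 * expR (- (b * x))) ->
  forall e : R, 0 < e -> \forall x \near +oo, tail G (a x) <= e * tail H x.
Proof.
move=> HE a_gt0 sqrt_a c10 c20 c30 l10 l20 b0 FL GL GU e e0.
pose l := l1 + l2.
have d0 : 0 < b / (l + 1) by rewrite divr_gt0// ltr_wpDl// addr_ge0.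
near=> x.
have x0 : 0 < x by near: x; exact: nbhs_pinfty_gt.
have ax := a_gt0 _ x0.
set r := Num.sqrt x.
have r0 : 0 < r by rewrite sqrtr_gt0.
have ra : (l + 1) * r <= b * a x.
  have : `|0 - Num.sqrt x / a x| <= b / (l + 1).
    by near: x; move/cvgrPdist_le : sqrt_a; apply.
  rewrite sub0r normrN ger0_norm ?divr_ge0 ?sqrtr_ge0 ?(ltW ax)//.
  by rewrite ler_pdivrMr// mulrAC ler_pdivlMr ?ltr_wpDl ?addr_ge0// mulrC.
have big : c3 / (e * c1 * c2) <= 1 + r.
  have : (c3 / (e * c1 * c2)) ^+ 2 <= x.
    by near: x; apply: nbhs_pinfty_ge; rewrite num_real.
  move=> h; have h2 : c3 / (e * c1 * c2) <= r.
    have q0 : 0 <= c3 / (e * c1 * c2) by rewrite ltW// divr_gt0// !mulr_gt0.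
    by rewrite -[leLHS](ger0_norm q0) -sqrtr_sqr; exact: ler_wsqrtr.
  by rewrite (le_trans h2)// lerDr.
have xr : x = r * r by rewrite -expr2 sqr_sqrtr// ltW.
have Hx : c1 * c2 * expR (- (l * r)) <= tail H x.
  have -> : c1 * c2 * expR (- (l * r)) =
      c1 * expR (- (l1 * r)) * (c2 * expR (- (l2 * r))).
    by rewrite mulrACA -expRD -opprD -mulrDl.
  rewrite xr; apply: le_trans (tail_product_ge HE (ltW r0) r0).
  by apply: ler_pM; rewrite ?mulr_ge0 ?expR_ge0 ?(ltW c10) ?(ltW c20)//;
    [apply: FL|apply: GL]; exact: ltW.
apply: (le_trans (GU _ (ltW ax))).
apply: (@le_trans _ _ (e * (c1 * c2 * expR (- (l * r))))); last by rewrite ler_pM2l.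
apply: (@le_trans _ _ (c3 * expR (- ((l + 1) * r)))).
  by rewrite ler_pM2l// ler_expR lerN2.
rewrite mulrDl mul1r opprD expRD mulrCA [leRHS]mulrA [leRHS]mulrC.
rewrite ler_pM2l ?expR_gt0//.
rewrite expRN ler_pdivrMr ?expR_gt0//.
apply: (@le_trans _ _ (e * (c1 * c2) * (1 + r))).
  by rewrite -ler_pdivrMl ?mulr_gt0// mulrC mulrA.
by rewrite ler_pM2l ?mulr_gt0// expR_ge1Dx.
Unshelve. all: by end_near. Qed.

End ExponentialBounds.

(** * Markov jump processes and phase-type laws *)

Section FiniteUnions.
Context (d : measure_display) (S : measurableType d) (R : realType)
  (P : probability S R).

Lemma pr_union_bound (I : finType) (A : set S) (B : I -> set S) :
  measurable A -> (forall i, measurable (B i)) ->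
  (forall w, A w -> exists i, B i w) -> pr P A <= \sum_i pr P (B i).
Proof.
move=> mA mB AB; pose U (s : seq I) := \big[setU/set0]_(i <- s) B i.
have mU s : measurable (U s) by exact: bigsetU_measurable.
have leU s : pr P (U s) <= \sum_(i <- s) pr P (B i).
  elim: s => [|i s IH]; first by rewrite /U !big_nil pr0.
  rewrite /U !big_cons; apply: (le_trans (prU_le _ _ _)) => //.
    exact: mU.
  by rewrite lerD2l.
apply: le_trans (leU _); apply: pr_le => // w /AB[i Bi].
by rewrite /U -bigcup_seq; exists i => //=; rewrite mem_index_enum.
Qed.

Lemma pr_partition (I : finType) (A : set S) (X : S -> I) :
  measurable A -> (forall i, measurable [set w | X w = i]) ->
  pr P A = \sum_i pr P (A `&` [set w | X w = i]).
Proof.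
move=> mA mX; pose U (s : seq I) := A `&` [set w | X w \in s].
have mXs (s : seq I) : measurable [set w | X w \in s].
  rewrite (_ : [set w | _] = \bigcup_(i in [set` s]) [set w | X w = i]).
    by rewrite bigcup_seq; exact: bigsetU_measurable.
  by apply/seteqP; split=> w /= => [Xs|[i /= si ->]//]; exists (X w).
suff H (s : seq I) : uniq s ->
    pr P (U s) = \sum_(i <- s) pr P (A `&` [set w | X w = i]).
  rewrite -(H _ (index_enum_uniq I)); congr pr; rewrite /U.
  by apply/seteqP; split=> w /= => [Aw|[]//]; rewrite mem_index_enum.
elim: s => [_|i s IH /= /andP[Nis us]].
  rewrite /U big_nil (_ : _ `&` _ = set0) ?pr0//.
  by apply/seteqP; split=> w //= -[].
rewrite big_cons -IH// -prU; [|exact: measurableI..|].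
  congr pr; apply/seteqP; split=> w; rewrite /U /= inE.
    by move=> [Aw /predU1P] []; [left|right].
  by move=> [[Aw ->]|[Aw Xs]]; split=> //; rewrite ?eqxx// Xs orbT.
by apply/seteqP; split=> w //= -[[_ Xi] [_ +]]; rewrite /= Xi (negbTE Nis).
Qed.

End FiniteUnions.

(** * Transition probabilities and returns of a jump process *)

Section MarkovJumpProcess.
Context (R : realType) (d : measure_display) (Omega : measurableType d)
  (P : probability Omega R) (n : nat) (mu : 'rV[R]_n) (Q : 'M[R]_n)
  (J : R -> Omega -> 'I_n).
Hypothesis JP : markov_jump_process P mu Q J.
Implicit Types (s t h : R) (i j : 'I_n).

Definition at_state (t : R) (i : 'I_n) : set Omega := [set w | J t w = i].

Lemma measurable_at_state t i : 0 <= t -> measurable (at_state t i).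
Proof. exact: (mjp_measurable JP). Qed.

Lemma mjp_two_times s h i j : 0 <= s -> 0 <= h ->
  pr P (at_state s i `&` at_state (s + h) j) =
  pr P (at_state s i) * mxexp (h *: Q) i j.
Proof.
move=> s0 h0; have sh0 : 0 <= s + h by exact: addr_ge0.
have ms := measurable_at_state i s0; have msh := measurable_at_state j sh0.
(* The Markov property is used with [m = 0]: the past is the single time [s]. *)
have nd : nondecreasing_seq (fun _ : nat => s) by [].
have := @mjp_markov _ _ _ _ _ _ _ _ JP 0 (fun=> s) (fun=> i) h j s0 nd h0.
rewrite /= (_ : [set w | forall k, _ -> _] = at_state s i); last first.
  by apply/seteqP; split=> w /=; [move=> /(_ 0%N isT)|move=> ? ?].
by move=> H; apply: EFin_inj; rewrite EFinM -!prK//; exact: measurableI.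
Qed.

(** Reads matrix entries as probabilities of a process started in [i]; nonnegativity, upper bounds
    and decay of return entries are obtained this way. *)
Lemma mjp_start t i j : mu ord0 i = 1 -> 0 <= t ->
  pr P (at_state t j) = mxexp (t *: Q) i j.
Proof.
move=> mui t0; have m0 := measurable_at_state i (lexx 0).
have mt := measurable_at_state j t0.
have P0 : pr P (at_state 0 i) = 1.
  by rewrite /pr /at_state (mjp_initial JP) mui.
have := mjp_two_times i j (lexx 0) t0; rewrite P0 mul1r add0r => <-.
rewrite -[LHS](_ : pr P ((at_state 0 i `&` at_state t j) `|`
  (at_state t j `&` ~` at_state 0 i)) = _); last first.
  by congr pr; rewrite setIC -setIUr setUv setIT.
rewrite prU; [|exact: measurableI|by apply: measurableI => //; exact: measurableC|].
  rewrite [X in _ + X](_ : _ = 0) ?addr0//; apply/eqP; rewrite eq_le pr_ge0 andbT.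
  have : pr P (~` at_state 0 i) = 0 by rewrite prC// P0 subrr.
  move=> null; rewrite -[leRHS]null.
  apply: pr_le; [|exact: measurableC|exact: subIsetr].
  by apply: measurableI => //; exact: measurableC.
by apply/seteqP; split=> w //= -[[? _] [_]].
Qed.

(** Only paths found in [i] at every multiple of [t] up to [k * t] are counted. *)
Lemma at_state_pow t i (k : nat) : 0 <= t -> 0 <= mxexp (t *: Q) i i ->
  mu ord0 i * mxexp (t *: Q) i i ^+ k <= pr P (at_state (k%:R * t) i).
Proof.
move=> t0 M0; elim: k => [|k IH].
  by rewrite mulr1 mul0r /pr /at_state (mjp_initial JP).
have kt0 : 0 <= k%:R * t by rewrite mulr_ge0.
have kt1 : 0 <= k%:R * t + t by rewrite addr_ge0.
rewrite exprSr mulrA; apply: le_trans (ler_wpM2r M0 IH) _.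
rewrite -mjp_two_times// -natr1 mulrDl mul1r; apply: pr_le.
- by apply: measurableI; exact: measurable_at_state.
- exact: measurable_at_state.
- by move=> w [].
Qed.

(** Otherwise the process started in [i] would almost surely be outside [i] at all times
    [1 / (m + 1)], while right-continuity keeps each path in [i] for a short time. *)
Lemma exists_positive_return i : mu ord0 i = 1 ->
  exists2 h : R, 0 < h & 0 < mxexp (h *: Q) i i.
Proof.
move=> mui; apply: contrapT => H.
pose s (m : nat) : R := m.+1%:R^-1.
have s0 m : 0 < s m by rewrite invr_gt0.
have null m : P (at_state (s m) i) = 0%E.
  have mm := measurable_at_state i (ltW (s0 m)).
  rewrite prK//; congr EFin; apply/eqP; rewrite eq_le pr_ge0 andbT leNgt.
  apply/negP; rewrite (mjp_start i mui (ltW (s0 m))) => M0; apply: H.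
  by exists (s m).
have : P.-negligible (\bigcup_m at_state (s m) i).
  apply: negligible_bigcup => m; apply/negligibleP; last exact: null.
  exact/measurable_at_state/ltW.
have sub : at_state 0 i `<=` \bigcup_m at_state (s m) i.
  move=> w J0; have [e e0 He] := mjp_right JP w (lexx 0).
  
  exists (Num.truncn e^-1) => //; rewrite /at_state /= He// add0r (ltW (s0 _))/=.
  by rewrite /s -[ltRHS]invrK ltf_pV2 ?posrE// ?invr_gt0// truncnS_gt.
move=> /(negligibleS sub)/negligibleP.
move=> /(_ (measurable_at_state i (lexx 0))).
move=> J0; suff [/eqP] : (1%:E = 0%:E :> \bar R) by rewrite oner_eq0.
by rewrite -mui -(mjp_initial JP); exact: J0.
Qed.

(** Visits to [i] at infinitely many integer times form a null event by transience; by continuity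
    from above, the probability of a visit at an integer time beyond [N] tends to zero. *)
Lemma transient_return i (e : R) : mu ord0 i = 1 ->
  P.-negligible [set w | forall t : R, exists2 s : R,
                           0 <= s /\ t <= s & J s w = i] -> 0 < e ->
  exists N : nat, forall k, (N <= k)%N -> mxexp (k%:R *: Q) i i <= e.
Proof.
move=> mui neg e0; pose A (k : nat) := at_state k%:R i.
have mA k : measurable (A k) by exact: measurable_at_state.
have mU k : measurable (\bigcup_(j >= k) A j) by exact: bigcup_measurable.
have lim0 : P (lim_sup_set A) = 0%E.
  apply/negligibleP; first exact: bigcap_measurable.
  apply: negligibleS neg => w Aw t.
  have [k /= tk Ak] := Aw (Num.truncn `|t|).+1 I.
  exists k%:R => //; split=> //; apply: le_trans (ler_norm t) (ltW _).
  by apply: (lt_le_trans (truncnS_gt _)); rewrite ler_nat.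
have fin : (P (\bigcup_(k >= 0) A k) < +oo)%E.
  by rewrite prK ?ltry//; exact: mU.
have := lim_sup_set_cvg P A mA fin.
rewrite [X in _ --> X](_ : _ = 0%E); last exact: lim0.
move=> /fine_cvgP[_ /cvgrPdist_le/(_ e e0)] [N _ HN].
exists N => k Nk; rewrite -(mjp_start i mui)//.
have := HN k Nk; rewrite /= sub0r normrN; apply: le_trans.
apply: le_trans (ler_norm _); apply: pr_le.
- exact: mA.
- exact: mU.
- by move=> w Aw; exists k => //=.
Qed.

End MarkovJumpProcess.

(** * Absorption and survival *)

Section AbsorbingRow.
Context (R : realType) (p : nat) (T : 'M[R]_p).

Let Q := absorbing_intensity T.

(** The absorbing row of the intensity matrix vanishes, hence so does that row of every positive
    power, and all nonempty partial sums coincide. *)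
Lemma mxexp_absorbing (h : R) (j : 'I_(p + 1)) :
  mxexp (h *: Q) (absorbing p) j = (absorbing p == j)%:R.
Proof.
rewrite mxE; set A := h *: Q.
have A0 l : A (absorbing p) l = 0.
  rewrite /A mxE /Q /absorbing_intensity /absorbing block_mxEh.
  rewrite mxE; case: split_ordP => k _; first by rewrite col_mxEd mxE mulr0.
  by rewrite col_mxEd mxE mulr0.
have Ak (k : nat) : (A ^+ k.+1) (absorbing p) j = 0.
  by rewrite exprS mxE big1// => l _; rewrite A0 mul0r.
apply/cvg_lim => //; apply: cvg_near_cst.
near=> m; rewrite /series/=.
have m0 : (0 < m)%N by near: m; exact: nbhs_infty_gt.
rewrite -(prednK m0) big_nat_recl// big1 ?addr0; last first.
  by move=> k _; rewrite Ak mul0r.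
by rewrite expr0 mxE fact0 divr1.
Unshelve. all: by end_near. Qed.

End AbsorbingRow.

Section AbsorptionTail.
Context (R : realType) (p : nat) (T : 'M[R]_p) (d : measure_display)
  (Omega : measurableType d) (P : probability Omega R) (mu : 'rV[R]_(p + 1))
  (J : R -> Omega -> 'I_(p + 1)).
Hypothesis JP : markov_jump_process P mu (absorbing_intensity T) J.

Let Q := absorbing_intensity T.
Let abs := absorbing p.

(** Expressed by the state at time [t]; [absorption_le] makes the link with [absorption_time]. *)
Definition survival (t : R) : R := pr P (~` at_state J t abs).

Lemma measurable_survival (t : R) : 0 <= t -> measurable (~` at_state J t abs).
Proof. by move=> t0; apply: measurableC; exact: (measurable_at_state JP). Qed.

Lemma pr_leave_state (s h : R) i j : 0 <= s -> 0 <= h ->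
  pr P (at_state J s i `&` ~` at_state J (s + h) j) =
  pr P (at_state J s i) * (1 - mxexp (h *: Q) i j).
Proof.
move=> s0 h0; have sh0 := addr_ge0 s0 h0.
have ms := measurable_at_state JP i s0; have msh := measurable_at_state JP j sh0.
have mC : measurable (~` at_state J (s + h) j) by exact: measurableC.
rewrite mulrBr mulr1 -(mjp_two_times JP)//.
rewrite -[X in X - _](_ : pr P ((at_state J s i `&` ~` at_state J (s + h) j)
  `|` (at_state J s i `&` at_state J (s + h) j)) = _); last first.
  by congr pr; rewrite -setIUr setUC setUv setIT.
rewrite prU ?addrK//; try exact: measurableI.
by apply/seteqP; split=> w //= -[[_ n] [_ ?]].
Qed.

Lemma pr_leave_absorbing (s t : R) : 0 <= s -> s <= t ->
  pr P (at_state J s abs `&` ~` at_state J t abs) = 0.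
Proof.
move=> s0 st; rewrite -(subrKC s t) pr_leave_state ?subr_ge0//.
by rewrite mxexp_absorbing eqxx subrr mulr0.
Qed.

(** Decompose by the state at time [s]: a transient state survives a further [h] with probability at
    most [q], and the absorbing state contributes zero. *)
Lemma survival_step (s h q : R) : 0 <= q -> 0 <= s -> 0 <= h ->
  (forall i : 'I_p, 1 - mxexp (h *: Q) (lshift 1 i) abs <= q) ->
  survival (s + h) <= q * survival s.
Proof.
move=> q0 s0 h0 Hq; have sh0 := addr_ge0 s0 h0.
have m i := measurable_at_state JP i s0.
rewrite /survival (pr_partition _ (measurable_survival sh0) m).
rewrite (pr_partition _ (measurable_survival s0) m) mulr_sumr.
apply: ler_sum => i _; rewrite -/(at_state J s i) setIC pr_leave_state//.
case: (split_ordP i) => k ->.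
  rewrite (_ : ~` at_state J s abs `&` _ = at_state J s (lshift 1 k)).
    by rewrite mulrC ler_wpM2r ?pr_ge0.
  apply/seteqP; split=> w /= => [[]//|Jk]; split=> //; rewrite /at_state/= Jk.
  by move/eqP; rewrite eq_lrshift.
rewrite (ord1 k) mxexp_absorbing eqxx subrr mulr0.
by rewrite mulr_ge0// pr_ge0.
Qed.

(** The events differ by paths that have been absorbed before [y] and have left again at [y]. By
    right-continuity such a path is absorbed at some rational time, so countably many null events
    suffice. *)
Lemma absorption_le (y : R) : 0 <= y ->
  P [set w | (absorption_time J w <= y%:E)%E] = P (at_state J y abs).
Proof.
move=> y0; set B := [set w | _].
(* An enumeration of the rational times in [[0, y]]; every other code gives the empty set. *)
pose C (n : nat) : set Omega := if unpickle n is Some q then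
  if 0 <= (ratr q : R) <= y then at_state J (ratr q) abs else set0 else set0.
have mC n : measurable (C n).
  rewrite /C; case: unpickle => // q; case: ifP => // /andP[q0 _].
  exact: (measurable_at_state JP).
have my := measurable_at_state JP abs y0.
have BE : B = at_state J y abs `|` \bigcup_n C n.
  apply/seteqP; split=> w; rewrite /B /=.
    move=> ty; have [Jy|Jy] := pselect (J y w = abs); [by left|right].
    have [e e0 He] := mjp_right JP w y0.
    have : (absorption_time J w < (y + e)%:E)%E.
      by apply: le_lt_trans ty _; rewrite lte_fin ltrDl.
    move=> /ereal_inf_lt[_ /= [t [t0 Jt] <-]]; rewrite lte_fin => te.
    (* A time in [[y, y + e)] would share the state at [y], which is not absorbing. *)
    have ty' : t < y.
      rewrite ltNge; apply/negP => yt; apply: Jy.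
      by rewrite -(He t) ?yt ?te.
    have [e' e'0 He'] := mjp_right JP w t0.
    have tm : t < Num.min y (t + e') by rewrite lt_min ty' ltrDl.
    have [q] := rat_in_itvoo tm.
    rewrite in_itv/= lt_min => /and3P[tq qy qe].
    exists (pickle q); [exact: I|rewrite /C pickleK].
    rewrite (le_trans t0 (ltW tq)) (ltW qy)/=.
    by rewrite /at_state/= He' ?(ltW tq).
  have inf_le t : 0 <= t -> J t w = abs -> (absorption_time J w <= t%:E)%E.
    by move=> t0 Jt; apply: ereal_inf_lbound; exists t.
  move=> [|[n _]]; first exact: inf_le.
  rewrite /C; case: unpickle => // q; case: ifP => // /andP[q0 qy] Jq.
  by apply: le_trans (inf_le _ q0 Jq) _; rewrite lee_fin.
have mB : measurable B by rewrite BE; apply: measurableU => //; exact: bigcupT_measurable.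
rewrite !prK//; congr EFin; apply/eqP; rewrite eq_le; apply/andP; split; last first.
  by apply: pr_le => //; rewrite BE; exact: subsetUl.
pose N := \bigcup_n (C n `&` ~` at_state J y abs).
have mN : measurable N.
  by apply: bigcupT_measurable => n; apply: measurableI => //; exact: measurableC.
have N0 : pr P N = 0.
  suff : P N = 0%E by rewrite /pr => ->.
  apply/negligibleP => //; apply: negligible_bigcup => n.
  apply/negligibleP; first by apply: measurableI => //; exact: measurableC.
  have mCn : measurable (C n `&` ~` at_state J y abs).
    by apply: measurableI => //; exact: measurableC.
  suff h : pr P (C n `&` ~` at_state J y abs) = 0 by rewrite [LHS]prK// h.
  rewrite /C; case: unpickle => [q|]; last by rewrite set0I pr0.
  case: ifP => [/andP[q0 qy]|_]; last by rewrite set0I pr0.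
  exact: pr_leave_absorbing.
rewrite -[leRHS]addr0 -[X in _ + X]N0; apply: le_trans (prU_le _ _ _) => //.
apply: pr_le => //; first exact: measurableU.
rewrite BE => w [Jy|[n _ Cn]]; first by left.
have [Jy|Jy] := pselect (at_state J y abs w); first by left.
by right; exists n.
Qed.

End AbsorptionTail.

(** * Exponential bounds for phase-type tails *)

Section PhaseType.
Context (R : realType) (p : nat) (T : 'M[R]_p).

Let Q := absorbing_intensity T.
Let abs := absorbing p.

Hypothesis T_transient : forall i : 'I_p, transient_state Q (lshift 1 i).

Lemma exists_half_life : exists2 h : R, 0 < h &
  forall i : 'I_p, 1 - mxexp (h *: Q) (lshift 1 i) abs <= 2^-1.
Proof.
(* An index [(a, b, j)] codes one way to survive: for [j] absorbing, absorption at [t a] followed by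
   an escape; otherwise visits to [j] at both [t a] and [t b]. The value of [e] makes the union
   bound equal to one half. *)
pose I : finType := ('I_p.+1 * 'I_p.+1 * 'I_(p + 1))%type.
have I0 : (0 : R) < #|I|%:R.
  by rewrite ltr0n; apply/card_gt0P; exists (ord0, ord0, abs).
pose e : R := (2 * #|I|%:R)^-1.
have e0 : 0 < e by rewrite invr_gt0 mulr_gt0.
have start (i : 'I_(p + 1)) : delta_mx (ord0 : 'I_1) i ord0 i = 1 :> R.
  by rewrite mxE !eqxx.
have /choice[N HN] : forall i : 'I_p, exists N : nat, forall k, (N <= k)%N ->
    0 <= mxexp (k%:R *: Q) (lshift 1 i) (lshift 1 i) <= e.
  move=> i; have [d [S [P [J [JP neg]]]]] := T_transient i.
  have [N HN] := transient_return JP (start _) neg e0.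
  exists N => k /HN ->; rewrite andbT.
  by rewrite -(mjp_start JP _ (start _)) ?pr_ge0.
(* Larger than every [N i], so the gap between any two distinct sampling times satisfies the return
   bound. *)
pose n := (\max_i N i).+1.
have Nn i m : (0 < m)%N -> (N i <= m * n)%N.
  move=> m0; apply: leq_trans (leq_pmull n m0).
  by rewrite leqW// leq_bigmax.
pose t (a : nat) : R := (a * n)%:R.
have t0 a : 0 <= t a by rewrite ler0n.
(* The pigeonhole uses the [p + 1] times [t 0], ..., [t p], all of them before the end time
   [t p.+1]. *)
exists (t p.+1); first by rewrite ltr0n muln_gt0.
move=> i0; have [d [S [P [J [JP _]]]]] := T_transient i0.
rewrite -(mjp_start JP _ (start _))// -prC; last exact: (measurable_at_state JP).
pose B (x : I) : set S := if x.2 == abs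
  then at_state J (t x.1.1) abs `&` ~` at_state J (t p.+1) abs
  else if (x.1.1 < x.1.2)%N
    then at_state J (t x.1.1) x.2 `&` at_state J (t x.1.2) x.2 else set0.
have mJ s j : measurable (at_state J (t s) j) by exact: (measurable_at_state JP).
have mB x : measurable (B x).
  rewrite /B; case: ifP => _; last by case: ifP => // _; exact: measurableI.
  by apply: measurableI => //; exact: measurableC.
have cover w : (~` at_state J (t p.+1) abs) w -> exists x, B x w.
  move=> Jw.
  have [[a Ja]|Na] := pselect (exists a : 'I_p.+1, J (t a) w = abs).
    by exists (a, ord0, abs); rewrite /B/= eqxx.
  have /choice[f Hf] : forall a : 'I_p.+1, exists k : 'I_p, J (t a) w = lshift 1 k.
    move=> a; case: (split_ordP (J (t a) w)) => k Jk; first by exists k.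
    by exfalso; apply: Na; exists a; rewrite Jk (ord1 k).
  have /injectivePn[a [b ab fab]] : ~~ injectiveb f.
    by apply/negP => /injectiveP/leq_card; rewrite !card_ord ltnn.
  wlog lt_ab : a b ab fab / (a < b)%N.
    move=> W; have [|ba|/val_inj/eqP] := ltngtP a b; first exact: W.
      by apply: (W b a) => //; rewrite eq_sym.
    by rewrite (negbTE ab).
  exists (a, b, lshift 1 (f a)); rewrite /B/= eq_lrshift lt_ab.
  by split; rewrite /at_state/= Hf ?fab.
have Be x : pr P (B x) <= e.
  rewrite /B; case: ifP => [_|jabs].
    rewrite (pr_leave_absorbing JP) ?(ltW e0)// /t ler_nat leq_mul//.
    by rewrite ltnW// ltn_ord.
  case: ifP => [ab|_]; last by rewrite pr0 ltW.
  case: x jabs ab => [[a b] j] /= jabs ab.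
  have -> : t b = t a + ((b - a) * n)%:R by rewrite -natrD -mulnDl subnKC// ltnW.
  rewrite (mjp_two_times JP)//.
  case: (split_ordP j) => k jk; last by move: jabs; rewrite jk (ord1 k) eqxx.
  have /andP[M0 Me] := HN k _ (Nn k (b - a)%N (ltac:(by rewrite subn_gt0))).
  rewrite jk -[leRHS]mul1r; apply: ler_pM => //; first exact: pr_ge0.
  exact: pr_le1.
have mS : measurable (~` at_state J (t p.+1) abs) by exact: measurableC.
apply: (le_trans (pr_union_bound P mS mB cover)).
apply: (@le_trans _ _ (\sum_(x : I) e)); first exact: ler_sum.
by rewrite sumr_const -[e *+ _]mulr_natr /e invfM -mulrA mulVf ?mulr1// gt_eqF.
Qed.

(** For [y >= 0] the tail is the survival probability. No initial mass is absorbed; repeated returns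
    to a state of positive initial mass give the lower bound, and halving over each half-life gives
    the upper one. *)
Lemma phase_type_bounds (d : measure_display) (Omega : measurableType d)
    (P : probability Omega R) (pi : 'rV[R]_p) (Y : {RV P >-> R}) :
  phase_type pi T Y ->
  let G := distribution P Y in
  [/\ tail G 0 = 1,
    exists c l : R, [/\ 0 < c, 0 <= l &
      forall y, 0 <= y -> c * expR (- (l * y)) <= tail G y] &
    exists c b : R, [/\ 0 < c, 0 < b &
      forall y, 0 <= y -> tail G y <= c * expR (- (b * y))]].
Proof.
move=> [[pi0 pi1] _ _ [d' [S [P' [J [JP cdfY]]]]]] G.
have tailG y : 0 <= y -> tail G y = survival P' J y.
  move=> y0; rewrite /survival prC; last exact: (measurable_at_state JP).
  rewrite -[LHS]/(fine (ccdf Y y)) ccdf_1_cdf cdfY (absorption_le JP)//.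
  by rewrite prK//; exact: (measurable_at_state JP).
have G_ni : {homo tail G : x y /~ x <= y} by move=> x y; exact: tail_le.
have half : 0 < (2^-1 : R) < 1 by apply/andP; split; lra.
split.
- rewrite tailG// /survival prC; last exact: (measurable_at_state JP).
  by rewrite /pr (mjp_initial JP) row_mxEr mxE subr0.
- have [i pii] : exists i, 0 < pi ord0 i.
    apply: contrapT => H; have : \sum_i pi ord0 i = 0.
      apply: big1 => i _; apply/eqP; rewrite eq_le pi0 andbT leNgt.
      by apply/negP => pii; apply: H; exists i.
    by rewrite pi1 => /eqP; rewrite oner_eq0.
  (* This auxiliary process controls an entry of [mxexp], and the resulting bounds then apply to
     [J]. *)
  have [d1 [S1 [P1 [J1 [JP1 _]]]]] := T_transient i.
  have start : delta_mx (ord0 : 'I_1) (lshift 1 i) ord0 (lshift 1 i) = 1 :> R.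
    by rewrite mxE !eqxx.
  have [h h0 M0] := exists_positive_return JP1 start.
  have M1 : mxexp (h *: Q) (lshift 1 i) (lshift 1 i) <= 1.
    rewrite -(mjp_start JP1 _ start) ?(ltW h0)//; apply: pr_le1.
    exact/(measurable_at_state JP1)/ltW.
  have q01 : 0 < mxexp (h *: Q) (lshift 1 i) (lshift 1 i) <= 1 by rewrite M0.
  apply: (geometric_lower G_ni h0 q01 pii) => k.
  have kh0 : 0 <= k%:R * h by rewrite mulr_ge0// ltW.
  rewrite tailG//.
  have := at_state_pow JP k (ltW h0) (ltW M0); rewrite row_mxEl => /le_trans; apply.
  apply: pr_le; first exact: (measurable_at_state JP).
    exact: (measurable_survival JP).
  by move=> w; rewrite /at_state /= => -> /eqP; rewrite eq_lrshift.
- have [h h0 Hh] := exists_half_life.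
  apply: (geometric_upper G_ni h0 half ltr01) => k; rewrite mul1r.
  elim: k => [|k IH]; first by rewrite mul0r expr0 tail_le1.
  have kh0 : 0 <= k%:R * h by rewrite mulr_ge0// ltW.
  rewrite tailG ?mulr_ge0// ?(ltW h0)// -natr1 mulrDl mul1r.
  apply: (le_trans (survival_step JP _ kh0 (ltW h0) Hh)); first lra.
  by rewrite -tailG// exprS ler_pM2l//; lra.
Qed.

End PhaseType.

(** * Products of independent random variables *)

(** By independence the law of [(Y, V)] agrees with the product measure on rectangles, hence
    everywhere. *)
Lemma distribution_mul (R : realType) (d : measure_display)
    (Omega : measurableType d) (P : probability Omega R)
    (V Y X : {RV P >-> R}) :
  independent_RV V Y -> (forall w, X w = V w * Y w) ->
  forall A : set R, measurable A -> distribution P X A =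
    (distribution P Y \x distribution P V)%E [set z | A (z.2 * z.1)].
Proof.
move=> VY XE A mA.
pose Z (w : Omega) := (Y w, V w).
have mZ : measurable_fun setT Z by exact: measurable_fun_pair.
pose ZI := isMeasurableFun.Build _ _ Omega (R * R)%type Z mZ.
pose ZM : {mfun Omega >-> (R * R)%type} := HB.pack Z ZI.
rewrite (@product_measure_unique _ _ R R R (distribution P Y) (distribution P V)
  (distribution P ZM)).
- rewrite /distribution /pushforward; congr (P _).
  by apply/seteqP; split=> w /=; rewrite XE.
- move=> B C mB mC; rewrite /distribution /pushforward muleC.
  by rewrite -[RHS]VY//; congr (P _); apply/seteqP; split=> w /= [].
- have mm : measurable_fun setT (fun z : R * R => z.2 * z.1).
    by apply: measurable_funM; [exact: measurable_snd|exact: measurable_fst].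
  by have := mm measurableT A mA; rewrite setTI.
Qed.

Theorem corollary3p10 (R : realType) (d : measure_display)
  (Omega : measurableType d) (P : probability Omega R)
  (V Y X : {RV P >-> R}) (p : nat) (pi : 'rV[R]_p) (T : 'M[R]_p) (a : R -> R)
  (V_ge0 : forall w, 0 <= V w)
  (V_subexp : subexponential (distribution P V))
  (Y_PH : phase_type pi T Y)
  (indep_VY : independent_RV V Y)
  (a_gt0 : forall x : R, 0 < x -> 0 < a x)
  (a_nd : forall x y : R, 0 < x -> x <= y -> a x <= a y)
  (a_cvg : a x @[x --> +oo] --> +oo)
  (xa_nd : forall x y : R, 0 < x -> x <= y -> x / a x <= y / a y)
  (xa_cvg : x / a x @[x --> +oo] --> +oo)
  (sqrt_a : Num.sqrt x / a x @[x --> +oo] --> (0 : R))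
  (V_tail : tail (distribution P V) (x - a x) / tail (distribution P V) x
              @[x --> +oo] --> (1 : R))
  (X_eq : forall w, X w = V w * Y w) :
  subexponential (distribution P X).
Proof.
have [_ _ T_transient _] := Y_PH.
have [_ V_gt0 _] := V_subexp.
have XE := distribution_mul indep_VY X_eq.
have [Y0 [c2 [l2 [c20 l20 YL]]] [c3 [b [c30 b0 YU]]]] :=
  phase_type_bounds T_transient Y_PH.
have [c1 [l1 [c10 l10 VL]]] := insensitive_tail_lower V_gt0 a_cvg V_tail.
(* This is the condition [P(Y > a(x)) = o(P(VY > x))]. *)
have dom := product_tail_dominates XE a_gt0 sqrt_a c10 c20 c30 l10 l20 b0 VL YL YU.
exact: (subexponential_product XE V_subexp Y0 a_gt0 a_nd a_cvg xa_nd xa_cvg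
  V_tail dom).
Qed.
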